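(* Let $\nu>0$, assume $f\in C^{1,1}_\nu(\mathbb{R}^n)$, and assume $f(\mathbf{u})\ge f^\star$ for all $\mathbf{u}\in\mathbb{R}^n$, where $f^\star\in\mathbb{R}$. Given a desired accuracy $\varepsilon>0$, run the basic simplicial search method (described in the context) on $f$ with simplex radius $\delta=\frac{2\varepsilon}{5n\nu}$ and with the added rule that, in each iteration before the computation of the reflection point, the algorithm terminates if $$f(\mathbf{x}_{n+1})-\frac1{n+1}\sum_{i=1}^{n+1}f(\mathbf{x}_i)\le2\nu\delta^2 .$$ Then the algorithm terminates in some iteration $k$ with $$\|Df(\mathbf{c}_k)\|\le\varepsilon\qquad\text{and}\qquad k\le\frac{25n^3\nu}{8\varepsilon^2}\Big[\frac1{n+1}\sum_{\mathbf{u}\in\Theta_0}f(\mathbf{u})-f^\star\Big],$$ where $\mathbf{c}_k$ is the center (the average of the $n+1$ points) of $\Theta_k$.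
   Context: $C^{1,1}_\nu(\mathbb{R}^n)$ is the class of continuously differentiable functions $f:\mathbb{R}^n\to\mathbb{R}$ with $\|Df(\mathbf{u})-Df(\mathbf{v})\|\le\nu\|\mathbf{u}-\mathbf{v}\|$ for all $\mathbf{u},\mathbf{v}$ (Euclidean norms). Regular simplex: an $n$-dimensional simplex with vertices $\{\mathbf{x}_1,\dots,\mathbf{x}_{n+1}\}\subset\mathbb{R}^n$ is a regular simplex with center $\mathbf{c}\in\mathbb{R}^n$ and radius $\delta>0$ if $\mathbf{c}=\frac1{n+1}\sum_{i=1}^{n+1}\mathbf{x}_i$ and there is an orthogonal matrix $Q\in\mathbb{R}^{(n+1)\times(n+1)}$ with $A=B_\delta Q$, where $A\in\mathbb{R}^{(n+1)\times(n+1)}$ has $i$th row $\begin{bmatrix}0&(\mathbf{x}_i-\mathbf{c})^T\end{bmatrix}$, $B=I_{n+1}-\frac{J_{n+1}}{n+1}$ ($J_{n+1}$ the all-ones matrix), and $B_\delta=\sqrt{\frac{n+1}{n}}\,\delta B$. (In particular each vertex is at distance $\delta$ from $\mathbf{c}$ and all edges have equal length.) Basic simplicial search method. Input: $f:\mathbb{R}^n\to\mathbb{R}$, $\mathbf{c}_0\in\mathbb{R}^n$, $\delta>0$. Construct a regular simplex with center $\mathbf{c}_0$ and radius $\delta$, and let $\Theta_0\subset\mathbb{R}^n$ be the set of its $n+1$ vertices. For $k=0,1,\dots$: (i) sort and label the points of $\Theta_k$ as $\{\mathbf{x}_i\}_{i=1}^{n+1}$ such that $f(\mathbf{x}_1)\le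 f(\mathbf{x}_2)\le\cdots\le f(\mathbf{x}_{n+1})$; (ii) compute the reflection point $\mathbf{x}_0=-\mathbf{x}_{n+1}+\frac2n\sum_{i=1}^n\mathbf{x}_i$; (iii) set $\Theta_{k+1}=(\Theta_k\setminus\{\mathbf{x}_{n+1}\})\cup\{\mathbf{x}_0\}$. The added stopping test is performed between (i) and (ii). *)

(* Defs.v *)
From HB Require Import structures.
From mathcomp Require Import all_boot all_order all_algebra finmap.
From mathcomp Require Import all_classical all_reals all_analysis.
Set Implicit Arguments.
Unset Strict Implicit.
Unset Printing Implicit Defensive.
Import Order.TTheory GRing.Theory Num.Theory.
Import numFieldNormedType.Exports.
Local Open Scope classical_set_scope.
Local Open Scope ring_scope.

(* R^n is 'rV[R]_n. The library norm `|u| on row vectors is the sup norm, so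
   the Euclidean norm is defined here. *)
Definition enorm (R : realType) (n : nat) (u : 'rV[R]_n) : R :=
  Num.sqrt (\sum_(i < n) u 0 i ^+ 2).

Definition grad (R : realType) (n : nat) (f : 'rV[R]_n -> R) (u : 'rV[R]_n) :
    'rV[R]_n :=
  \row_(i < n) 'D_(delta_mx 0 i) f u.

Definition C11 (R : realType) (n : nat) (nu : R) (f : 'rV[R]_n -> R) : Prop :=
  [/\ forall u, differentiable f u,
      continuous (grad f) &
      forall u v, enorm (grad f u - grad f v) <= nu * enorm (u - v)].

(* In a labeling x : 'I_n.+1 -> 'rV_n the index i stands for the usual
   i + 1; in particular ord_max is the index of x_{n+1}. *)
Definition labels_simplex (R : realType) (n : nat) (x : 'I_n.+1 -> 'rV[R]_n)
    (V : {fset 'rV[R]_n}) : Prop :=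
  set_bij [set: 'I_n.+1] [set` V] x.

Definition affinely_independent (R : realType) (n : nat)
    (x : 'I_n.+1 -> 'rV[R]_n) : Prop :=
  row_free (\matrix_(i < n) (x (lift ord0 i) - x ord0)).

Definition centering_mx (R : realType) (n : nat) : 'M[R]_n.+1 :=
  1%:M - n.+1%:R^-1 *: const_mx 1.

Definition regular_simplex (R : realType) (n : nat) (V : {fset 'rV[R]_n})
    (c : 'rV[R]_n) (delta : R) : Prop :=
  0 < delta /\
  exists x : 'I_n.+1 -> 'rV[R]_n,
    [/\ labels_simplex x V,
        affinely_independent x,
        c = n.+1%:R^-1 *: \sum_(i < n.+1) x i &
        exists Q : 'M[R]_n.+1,
          Q *m Q^T = 1%:M /\
          \matrix_(i < n.+1) row_mx (0 : 'rV[R]_1) (x i - c) =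
          ((Num.sqrt (n.+1%:R / n%:R) * delta) *: centering_mx R n) *m Q].

Definition simplex_center (R : realType) (n : nat) (V : {fset 'rV[R]_n}) : 'rV[R]_n :=
  n.+1%:R^-1 *: \sum_(u <- V) u.

Definition reflection_point (R : realType) (n : nat) (x : 'I_n.+1 -> 'rV[R]_n) :
    'rV[R]_n :=
  - x ord_max + (2 / n%:R) *: \sum_(i < n) x (widen_ord (leqnSn n) i).

Definition terminates_at (R : realType) (n : nat)
    (stop : ('I_n.+1 -> 'rV[R]_n) -> bool)
    (x : nat -> 'I_n.+1 -> 'rV[R]_n) (k : nat) : Prop :=
  (forall j, (j < k)%N -> ~~ stop (x j)) /\ stop (x k).

(* Theta k and x k are the simplex and its sorted labeling at iteration k.
   Neither is constrained after the first iteration at which the test holds,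
   so finite and infinite executions are both represented. The initial simplex
   and the order of points with equal values are arbitrary. *)
Definition simplicial_search_run (R : realType) (n : nat)
    (f : 'rV[R]_n -> R) (c0 : 'rV[R]_n) (delta : R)
    (stop : ('I_n.+1 -> 'rV[R]_n) -> bool)
    (Theta : nat -> {fset 'rV[R]_n}) (x : nat -> 'I_n.+1 -> 'rV[R]_n) : Prop :=
  [/\ regular_simplex (Theta 0%N) c0 delta,
      forall k, (forall j, (j < k)%N -> ~~ stop (x j)) ->
        labels_simplex (x k) (Theta k) /\
        (forall i j : 'I_n.+1, (i <= j)%N -> f (x k i) <= f (x k j)) &
      forall k, (forall j, (j <= k)%N -> ~~ stop (x j)) ->
        Theta k.+1 =
          ((Theta k `\ x k ord_max) `|` [fset reflection_point (x k)])%fset].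

Definition stopping_test (R : realType) (n : nat) (f : 'rV[R]_n -> R)
    (nu delta : R) (x : 'I_n.+1 -> 'rV[R]_n) : bool :=
  f (x ord_max) - n.+1%:R^-1 * \sum_(i < n.+1) f (x i) <= 2 * nu * delta ^+ 2.

(* Main.v *)
Require Import Defs.
From mathcomp Require Import all_boot all_order all_algebra finmap.
From mathcomp Require Import all_classical all_reals all_analysis.
From mathcomp Require Import ring lra.
Import Order.TTheory GRing.Theory Num.Theory.
Import numFieldNormedType.Exports.
Local Open Scope classical_set_scope.
Local Open Scope ring_scope.

Set Implicit Arguments.
Unset Strict Implicit.
Unset Printing Implicit Defensive.

(** The argument follows the average value of [f] over the current simplex.

Every simplex met by the method is regular of radius [delta]: a reflection
sends the worst vertex to a point at the same distance from the others. This
is tracked through squared edge lengths only, since they do not depend on the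
labeling of the vertices; all other metric facts come from the Gram matrix of
the vertices relative to their mean [c], which the edge lengths determine
([equilateral_gram], [equilateral_reflect]).

Reflection replaces [z] by [2 g - z], where [g] is the centroid of the
opposite face. Linear extrapolation from the old vertices predicts the value
[2 avg_face f - f z] at the new point, and the quadratic bound on the Taylor
remainder at [g] shows that the true value exceeds the prediction by at most
[nu] times the squared edge length ([reflection_value]). When the test fails,
[f z] is so far above the average that twice its excess over the face pays for
this error with as much to spare, so the average drops by at least
[2 nu delta^2 / n] ([mean_decrease]). The average stays above [fstar], hence
the method stops, and the number of steps is bounded.

When the test succeeds, no vertex value exceeds the average by more than
[2 nu delta^2]. Up to Taylor remainders this bounds [g.(x_i - c)] from above
for each [i], where now [g] is the gradient at [c]. The vectors [x_i - c] of a
regular simplex form a tight frame: the sum of [(g.(x_i - c))^2] is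
[(n+1)/n delta^2 |g|^2] ([equilateral_tight]). Together with
[sum_i g.(x_i - c) = 0] this turns the one-sided bounds into the bound
[5/2 n nu delta = eps] on [|g|] ([gradient_bound]). *)

(** * The Euclidean inner product *)

Section Dot.
Variables (R : realType) (n : nat).
Implicit Types u v w : 'rV[R]_n.

Definition dot u v : R := \sum_(i < n) u 0 i * v 0 i.

Lemma dotC u v : dot u v = dot v u.
Proof. by apply: eq_bigr => i _; rewrite mulrC. Qed.

Lemma dotDl u v w : dot (u + v) w = dot u w + dot v w.
Proof. by rewrite -big_split; apply: eq_bigr => i _; rewrite mxE mulrDl. Qed.

Lemma dotZl a u v : dot (a *: u) v = a * dot u v.
Proof. by rewrite mulr_sumr; apply: eq_bigr => i _; rewrite mxE mulrA. Qed.

Lemma dotDr u v w : dot u (v + w) = dot u v + dot u w.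
Proof. by rewrite dotC dotDl !(dotC u). Qed.

Lemma dotZr a u v : dot u (a *: v) = a * dot u v.
Proof. by rewrite dotC dotZl dotC. Qed.

Lemma dotNl u v : dot (- u) v = - dot u v.
Proof. by rewrite -scaleN1r dotZl mulN1r. Qed.

Lemma dotNr u v : dot u (- v) = - dot u v.
Proof. by rewrite dotC dotNl dotC. Qed.

Lemma dot0r u : dot u 0 = 0.
Proof. by rewrite -(scale0r 0) dotZr mul0r. Qed.

Lemma dot_sumr I (r : seq I) u (F : I -> 'rV[R]_n) :
  dot u (\sum_(i <- r) F i) = \sum_(i <- r) dot u (F i).
Proof. exact: (big_morph _ (dotDr u) (dot0r u)). Qed.

Lemma dotB2 u v :
  dot (u - v) (u - v) = dot u u + dot v v - 2 * dot u v.
Proof. by rewrite dotDl dotNl !dotDr !dotNr (dotC v u); ring. Qed.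

Lemma dot_ge0 u : 0 <= dot u u.
Proof. by apply: sumr_ge0 => i _; rewrite -expr2 sqr_ge0. Qed.

Lemma enormE u : enorm u = Num.sqrt (dot u u).
Proof. by congr Num.sqrt; apply: eq_bigr => i _; rewrite expr2. Qed.

Lemma enorm_ge0 u : 0 <= enorm u.
Proof. exact: sqrtr_ge0. Qed.

Lemma enorm_sqr u : enorm u ^+ 2 = dot u u.
Proof. by rewrite enormE sqr_sqrtr// dot_ge0. Qed.

Lemma dot_eq0 u : dot u u = 0 -> u = 0.
Proof.
move=> u0; apply/rowP => i; rewrite mxE; apply/eqP; rewrite -sqrf_eq0 expr2.
move: u0 => /eqP; rewrite psumr_eq0; last by move=> j _; rewrite -expr2 sqr_ge0.
by move=> /allP/(_ i (mem_index_enum _)).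
Qed.

(** Expand [|a v - b u|^2 >= 0] at [a = u.u] and [b = u.v]. *)
Lemma dot_cauchy u v : `|dot u v| <= enorm u * enorm v.
Proof.
have [uu0|uu0] := eqVneq (dot u u) 0.
  have -> : dot u v = 0 by rewrite (dot_eq0 uu0) dotC dot0r.
  by rewrite normr0 mulr_ge0 ?enorm_ge0.
have uu_gt0 : 0 < dot u u by rewrite lt_def uu0 dot_ge0.
rewrite -ler_sqr ?nnegrE ?mulr_ge0 ?enorm_ge0 ?normr_ge0//.
rewrite exprMn !enorm_sqr real_normK ?num_real// -subr_ge0.
rewrite -(pmulr_rge0 _ uu_gt0).
have := dot_ge0 (dot u u *: v - dot u v *: u).
by rewrite dotB2 !dotZl !dotZr (dotC v u); lra.
Qed.

End Dot.

(** * The quadratic bound on the Taylor remainder *)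

Section Taylor.
Variables (R : realType) (n : nat) (nu : R) (f : 'rV[R]_n -> R).

Lemma dot_grad u v : differentiable f u -> dot (grad f u) v = 'D_v f u.
Proof.
move=> fu; rewrite {2}(matrix_sum_delta v) big_ord1 deriveE//.
rewrite linear_sum; apply: eq_bigr => i _.
by rewrite linearZ /= mxE deriveE// mulrC.
Qed.

Lemma is_derive_line u d t : differentiable f (u + t *: d) ->
  is_derive t (1 : R) (fun t => f (u + t *: d)) ('D_d f (u + t *: d)).
Proof.
move=> fu.
have E : (fun h : R => h^-1 *: (((fun t => f (u + t *: d)) \o shift t) (h *: (1:R))
            - f (u + t *: d)))
       = (fun h : R => h^-1 *: ((f \o shift (u + t *: d)) (h *: d) - f (u + t *: d))).
  apply/funext => h /=; congr (_ *: (f _ - _)).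
  by rewrite -[h *: 1]/(h * 1) mulr1 scalerDl addrCA.
split; first by have := @diff_derivable _ _ _ _ _ d fu; rewrite /derivable E.
by rewrite /derive E.
Qed.

(** Along the segment from [u] to [u + d], the derivative of the signed remainder
minus [nu / 2 * t^2 * |d|^2] is nonpositive by the Lipschitz bound and
Cauchy-Schwarz, so the mean value theorem applies. The sign [sg] makes one
argument serve for both sides of the bound. *)
Lemma C11_taylor_signed (sg : R) u d : `|sg| = 1 -> C11 nu f ->
  sg * (f (u + d) - f u - dot (grad f u) d) <= nu / 2 * dot d d.
Proof.
move=> sg1 [df _ lip].
pose p : {poly R} := (sg * dot (grad f u) d) *: 'X + (nu / 2 * dot d d) *: 'X^2.
have pE t : p.[t] = sg * dot (grad f u) d * t + nu / 2 * dot d d * t ^+ 2.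
  by rewrite !(hornerD, hornerZ, hornerX, hornerXn).
have dpE t : p^`().[t] = sg * dot (grad f u) d + nu * dot d d * t.
  rewrite !(derivD, derivZ, derivX, derivXn).
  rewrite !(hornerD, hornerZ, hornerC, hornerMn) /= expr1.
  by rewrite hornerX; field.
pose psi t := sg * f (u + t *: d) - p.[t].
pose dpsi t := sg * dot (grad f (u + t *: d)) d - p^`().[t].
have psiD t : is_derive t (1 : R) psi (dpsi t).
  apply: is_deriveB; rewrite dot_grad//.
  by apply: (@is_deriveZ _ _ _ _ sg); exact: is_derive_line.
have psi_cont : {within `[0, 1], continuous psi}.
  by apply: derivable_within_continuous => t _; exact: ex_derive.
have [t + E] := MVT ltr01 (fun t _ => psiD t) psi_cont.
rewrite in_itv /= => /andP[t0 _].
suff : dpsi t <= 0.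
  move: E; rewrite subr0 mulr1 => <-; rewrite /psi scale1r scale0r addr0.
  rewrite !pE; lra.
rewrite /dpsi dpE.
have cs := dot_cauchy (grad f (u + t *: d) - grad f u) d.
have := lip (u + t *: d) u; rewrite [u + _]addrC addrK.
have -> : enorm (t *: d) = t * enorm d.
  rewrite !enormE dotZl dotZr mulrA -expr2 sqrtrM ?sqr_ge0// sqrtr_sqr.
  by rewrite ger0_norm// ltW.
rewrite [_ + u]addrC => {}lip.
have : sg * dot (grad f (u + t *: d) - grad f u) d <= nu * t * dot d d.
  apply: le_trans (ler_norm _) _; rewrite normrM sg1 mul1r.
  apply: le_trans cs _; rewrite -enorm_sqr expr2 !mulrA.
  by rewrite ler_wpM2r ?enorm_ge0// -mulrA.
rewrite dotDl dotNl; lra.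
Qed.

Lemma C11_taylor u v : C11 nu f ->
  `|f v - f u - dot (grad f u) (v - u)| <= nu / 2 * dot (v - u) (v - u).
Proof.
move=> fC; have -> : f v = f (u + (v - u)) by rewrite addrC subrK.
rewrite ler_norml.
have := C11_taylor_signed u (v - u) (normr1 R) fC.
have := C11_taylor_signed u (v - u) (normrN1 R) fC.
by move=> A B; apply/andP; split; lra.
Qed.

End Taylor.

(** * The geometry of regular simplices *)

Section Simplex.
Variables (R : realType) (n : nat).
Implicit Types (s : R) (x : 'I_n.+1 -> 'rV[R]_n).

Definition mean (V : lmodType R) (y : 'I_n.+1 -> V) : V :=
  n.+1%:R^-1 *: \sum_(i < n.+1) y i.

Lemma sum_sub_mean (V : lmodType R) (y : 'I_n.+1 -> V) :
  \sum_(i < n.+1) (y i - mean y) = 0.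
Proof.
rewrite sumrB sumr_const card_ord -scaler_nat scalerA divff ?pnatr_eq0//.
by rewrite scale1r subrr.
Qed.

(** The scale [s] is half of the squared edge length: with this choice the Gram
matrix of the centered vertices is [s] times the centering matrix. *)
Definition equilateral s x :=
  forall i j, dot (x i - x j) (x i - x j) = 2 * s * (i != j)%:R.

Lemma sum_pred1 (i : 'I_n.+1) : \sum_(j < n.+1) ((i == j)%:R : R) = 1.
Proof.
by rewrite (bigD1 i)//= eqxx big1 ?addr0// => j; rewrite eq_sym => /negbTE->.
Qed.

Lemma gram_equilateral s x c :
  (forall i j, dot (x i - c) (x j - c) = s * ((i == j)%:R - n.+1%:R^-1)) ->
  equilateral s x.
Proof.
move=> G i j; have -> : x i - x j = (x i - c) - (x j - c).
  by rewrite opprB addrA subrK.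
by rewrite dotB2 !G !eqxx; case: eqVneq => _ /=; ring.
Qed.

(** Summing [|y_i|^2 + |y_j|^2 - 2 y_i.y_j = 2 s (1 - delta_ij)] over [j], and
then over [i] and [j], with [sum_i y_i = 0], gives all the [|y_i|^2]; the
polarization identity then gives the products. *)
Lemma equilateral_gram s x i j : equilateral s x ->
  dot (x i - mean x) (x j - mean x) = s * ((i == j)%:R - n.+1%:R^-1).
Proof.
move=> xE; pose y i := x i - mean x.
have n1 : n.+1%:R != 0 :> R by rewrite pnatr_eq0.
have E k l : dot (y k) (y k) + dot (y l) (y l) - 2 * dot (y k) (y l)
           = 2 * s * (1 - (k == l)%:R).
  rewrite -dotB2 /y opprB addrA subrK xE.
  by case: eqVneq => _ /=; rewrite ?subrr ?subr0.
have y0 : \sum_k y k = 0 by exact: sum_sub_mean.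
pose S := \sum_k dot (y k) (y k).
have P k : n.+1%:R * dot (y k) (y k) + S = 2 * s * (n.+1%:R - 1).
  have : \sum_l (dot (y k) (y k) + dot (y l) (y l) - 2 * dot (y k) (y l))
       = \sum_l 2 * s * (1 - (k == l)%:R) by apply: eq_bigr => l _; exact: E.
  rewrite -mulr_sumr !sumrB big_split /= sum_pred1 -mulr_sumr -(dot_sumr _ (y k) y).
  rewrite y0 dot0r mulr0 subr0 !sumr_const card_ord.
  by rewrite -[X in X + _]mulr_natl.
have SE : S = s * (n.+1%:R - 1).
  have : \sum_k (n.+1%:R * dot (y k) (y k) + S)
       = \sum_(k < n.+1) 2 * s * (n.+1%:R - 1) by apply: eq_bigr => k _; exact: P.
  rewrite big_split /= -mulr_sumr -/S !sumr_const card_ord -[S *+ _]mulr_natl.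
  by rewrite -[RHS]mulr_natl => H; apply: (mulfI n1); lra.
have PE k : dot (y k) (y k) = s * (1 - n.+1%:R^-1).
  apply: (mulfI n1); rewrite mulrCA mulrBr mulfV//.
  by have := P k; rewrite SE => /(canRL (addrK _)) ->; ring.
have := E i j; rewrite !PE -/(y i) -/(y j).
by set u := _^-1; lra.
Qed.

(** The matrices [[1 | X]] and [[s/(n+1) | X]], with the vectors [x i - mean x]
as rows of [X], are square, and the Gram matrix of the simplex says that the
first times the transpose of the second is [s] times the identity. The product
in the other order is then the same, and [X^T X] is a block of it. *)
Lemma equilateral_tight s x g : s != 0 -> equilateral s x ->
  \sum_i dot g (x i - mean x) ^+ 2 = s * dot g g.
Proof.
move=> s0 xE.
pose X : 'M[R]_(n.+1, n) := \matrix_i (x i - mean x).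
pose M : 'M[R]_(n.+1, 1 + n) := row_mx (const_mx 1) X.
pose N : 'M[R]_(n.+1, 1 + n) := row_mx (const_mx (s / n.+1%:R)) X.
have MN : M *m (s^-1 *: N^T) = 1%:M.
  rewrite -scalemxAr tr_row_mx mul_row_col; apply/matrixP => i j.
  have XX : (X *m X^T) i j = s * ((i == j)%:R - n.+1%:R^-1).
    rewrite -(equilateral_gram i j xE) mxE.
    by apply: eq_bigr => k _; rewrite !mxE.
  rewrite 2!mxE XX !mxE big_ord1 !mxE.
  by field; rewrite s0 nat1r pnatr_eq0.
have NM : (s^-1 *: N^T) *m M = 1%:M by exact: mulmx1C MN.
move: NM; rewrite -scalemxAl tr_row_mx mul_col_row => /(congr1 (fun A => s *: A)).
rewrite scalerA divff// scale1r scalemx1 scalar_mx_block.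
move=> /eq_block_mx[_ _ _ XX].
have gX i : dot g (x i - mean x) = (g *m X^T) 0 i.
  by rewrite mxE; apply: eq_bigr => k _; rewrite !mxE.
have -> : \sum_i dot g (x i - mean x) ^+ 2 = ((g *m X^T) *m (g *m X^T)^T) 0 0.
  by rewrite mxE; apply: eq_bigr => i _; rewrite gX expr2 [_^T _ _]mxE.
rewrite trmx_mul trmxK mulmxA -(mulmxA g) XX mul_mx_scalar -scalemxAl mxE.
by congr (_ * _); rewrite mxE; apply: eq_bigr => k _; rewrite mxE.
Qed.

Definition reflect_vertex x (i : 'I_n.+1) : 'rV[R]_n :=
  if i == ord_max then reflection_point x else x i.

Hypothesis n_gt0 : (0 < n)%N.

(** The other centered vertices sum to minus the centered worst one, so seen from
the old center the reflection is a multiple of the latter. *)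
Lemma reflection_pointE x :
  reflection_point x - mean x
  = - ((n%:R + 2) / n%:R) *: (x ord_max - mean x).
Proof.
have n0 : n%:R != 0 :> R by rewrite pnatr_eq0 -lt0n.
have n1 : 1 + n%:R != 0 :> R by rewrite nat1r pnatr_eq0.
have : \sum_(i < n.+1) x i = n.+1%:R *: mean x.
  by rewrite scalerA divff ?pnatr_eq0// scale1r.
rewrite big_ord_recr /= => /(canRL (addrK _)) E.
rewrite /reflection_point E; apply/rowP => k; rewrite !mxE.
by field; rewrite n1 n0.
Qed.

Lemma equilateral_reflect s x :
  equilateral s x -> equilateral s (reflect_vertex x).
Proof.
move=> xE.
have n0 : n%:R != 0 :> R by rewrite pnatr_eq0 -lt0n.
have n1 : 1 + n%:R != 0 :> R by rewrite nat1r pnatr_eq0.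
have E j : j != ord_max ->
    dot (reflection_point x - x j) (reflection_point x - x j) = 2 * s.
  move=> /negbTE jn.
  have -> : reflection_point x - x j
          = - ((n%:R + 2) / n%:R) *: (x ord_max - mean x) - (x j - mean x).
    by rewrite -reflection_pointE opprB addrA subrK.
  rewrite dotB2 !dotZl !dotZr !(equilateral_gram _ _ xE) !eqxx (eq_sym _ j) jn /=.
  by field; rewrite n1 n0.
move=> i j; rewrite /reflect_vertex.
case: (eqVneq i ord_max) => [->|im]; case: (eqVneq j ord_max) => [jm|jm] /=.
- by rewrite subrr dot0r mulr0.
- by rewrite E// mulr1.
- by rewrite jm -opprB dotNl dotNr opprK E// im mulr1.
- exact: xE.
Qed.

End Simplex.

(** * One iteration of the search *)

Section Estimates.
Variables (R : realType) (n : nat) (n_gt0 : (0 < n)%N).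
Variables (nu : R) (nu_gt0 : 0 < nu) (f : 'rV[R]_n -> R) (f_C11 : C11 nu f).
Implicit Types (x : 'I_n.+1 -> 'rV[R]_n) (s : R).

Let n0 : n%:R != 0 :> R. Proof. by rewrite pnatr_eq0 -lt0n. Qed.
Let n1 : 1 + n%:R != 0 :> R. Proof. by rewrite nat1r pnatr_eq0. Qed.

(** In terms of the face centroid [g], the points are [z = g + h], the reflection
[g - h], and the face vertices [w_i], whose deviations from [g] sum to zero; so
all first order terms at [g] cancel. The remainders are bounded by
[nu * (|h|^2 + |w_i - g|^2)], and [|h|^2 + |w_i - g|^2] is the squared edge
length [2 s] because the altitude [h] is orthogonal to the face. *)
Lemma reflection_value s x : equilateral s x ->
  f (reflection_point x) + f (x ord_max)
  - 2 / n%:R * (\sum_(i < n) f (x (widen_ord (leqnSn n) i))) <= 2 * nu * s.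
Proof.
move=> xE; set z := x ord_max; set w := fun i => x (widen_ord (leqnSn n) i).
pose g := mean x - n%:R^-1 *: (z - mean x).
have gram := equilateral_gram _ _ xE.
have wg i : dot (w i - g) (w i - g) = s * (n%:R - 1) / n%:R.
  have -> : w i - g = n%:R^-1 *: (z - mean x) + (w i - mean x).
    by apply/rowP => k; rewrite !mxE; ring.
  rewrite dotDl !(dotDr _ (_ *: _)) !dotZl !dotZr (dotC (w i - _)).
  have /negbTE zi : ord_max != widen_ord (leqnSn n) i :> 'I_n.+1.
    by rewrite -val_eqE /= eq_sym ltn_eqF.
  by rewrite /w /z !gram !eqxx zi /=; field; rewrite n1 n0.
have zg : dot (z - g) (z - g) = s * (n%:R + 1) / n%:R.
  have -> : z - g = (1 + n%:R^-1) *: (z - mean x).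
    by apply/rowP => k; rewrite !mxE; ring.
  by rewrite dotZl dotZr gram eqxx /=; field; rewrite n1 n0.
have rg : reflection_point x - g = - (z - g).
  rewrite -[reflection_point x](subrK (mean x)) reflection_pointE//.
  by apply/rowP => k; rewrite !mxE -/z; field; rewrite n1 n0.
have sw : \sum_i (w i - g) = 0.
  have zE : \sum_(i < n) n%:R^-1 *: (z - mean x) = z - mean x.
    by rewrite sumr_const card_ord -scaler_nat scalerA divff// scale1r.
  have := sum_sub_mean x; rewrite big_ord_recr /= -/z -{1}zE -big_split /= => E.
  apply: etrans E; apply: eq_bigr => i _.
  by apply/rowP => k; rewrite !mxE; ring.
have up1 := C11_taylor g (reflection_point x) f_C11.
have up2 := C11_taylor g z f_C11.
rewrite rg !dotNr dotNl opprK zg in up1; rewrite zg in up2.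
have lo : n%:R * (f g - nu / 2 * (s * (n%:R - 1) / n%:R)) <= \sum_i f (w i).
  rewrite -[_ * _]addr0 -[X in _ + X](dot0r (grad f g)) -sw dot_sumr.
  rewrite [n%:R * _]mulr_natl -[n in _ *+ n]card_ord -sumr_const -big_split /=.
  apply: ler_sum => i _; have := C11_taylor g (w i) f_C11.
  by rewrite wg ler_norml => /andP[+ _]; lra.
have n_pos : 0 < n%:R :> R by rewrite ltr0n.
have lo' : f g - nu / 2 * (s * (n%:R - 1) / n%:R) <= n%:R^-1 * \sum_i f (w i).
  by rewrite ler_pdivlMl.
move: up1 up2; rewrite !ler_norml => /andP[_ up1] /andP[_ up2].
have E : nu * (s * (n%:R + 1) / n%:R) + nu * (s * (n%:R - 1) / n%:R) = 2 * nu * s.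
  by field.
rewrite -E -[2 / _ * _]mulrA.
by move: lo' up1 up2; rewrite /w /=; lra.
Qed.

(** The excess of the worst value over the average is [n/(n+1)] times its excess
over the face average. The hypothesis thus makes the latter exceed [2 nu s],
and the new value is below the old one by at least
[2 * (2 nu s) - 2 nu s = 2 nu s]. *)
Lemma mean_decrease s x : equilateral s x ->
  2 * n%:R / n.+1%:R * (nu * s) < f (x ord_max) - mean (fun i => f (x i)) ->
  mean (fun i => f (reflect_vertex x i))
  <= mean (fun i => f (x i)) - 2 * (nu * s) / n.+1%:R.
Proof.
move=> xE; have := reflection_value xE; rewrite /mean !big_ord_recr /=.
set F := \sum_(i < n) f (x _).
have -> : \sum_(i < n) f (reflect_vertex x (widen_ord (leqnSn n) i)) = F.
  apply: eq_bigr => i _; rewrite /reflect_vertex ifN//.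
  by rewrite -val_eqE /= ltn_eqF.
rewrite /reflect_vertex eqxx -!/(_ * _) => fr gap.
have Np : 0 < n%:R :> R by rewrite ltr0n.
have N1p : 0 < n.+1%:R :> R by rewrite ltr0n.
have {}gap : 2 * (nu * s) < f (x ord_max) - n%:R^-1 * F.
  rewrite -(ltr_pM2l (divr_gt0 Np N1p)).
  have -> : n%:R / n.+1%:R * (2 * (nu * s)) = 2 * n%:R / n.+1%:R * (nu * s) by ring.
  apply: lt_le_trans gap _; rewrite le_eqVlt; apply/orP; left; apply/eqP.
  by rewrite -[_ *: _]/(_ * _); field; rewrite n1 n0.
rewrite -[_ *: (F + f (reflection_point x))]/(_ * _).
rewrite -[_ *: (F + f (x ord_max))]/(_ * _).
rewrite -(ler_pM2l N1p) mulrBr [_ * (_ / _)]mulrC divfK ?gt_eqF//.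
rewrite !mulVKf ?gt_eqF//; lra.
Qed.

(** Let [c] be the mean of the vertices, [g] the gradient there, [l] its norm, and
[m] the mean of the values. Write [a_i = g.(x_i - c)], [F_i = f(x_i) - m] and
[e_i] for the Taylor remainders at [c]. Then [sum a_i^2 = sum a_i (F_i - e_i)],
since [sum a_i = 0] absorbs the constant [m - f(c)]. As [|a_i| <= l delta] and
[sum F_i = 0], replacing [a_i F_i] by [(a_i + l delta) F_i] does not change the
sum and makes the upper bound [F_i <= b] usable. Dividing the tight frame
identity by [l] gives the result. *)
Lemma gradient_bound (delta b : R) x : 0 < delta ->
  equilateral (n.+1%:R / n%:R * delta ^+ 2) x ->
  (forall i, f (x i) - mean (fun i => f (x i)) <= b) ->
  enorm (grad f (mean x)) <= n%:R / delta * (b + nu / 2 * delta ^+ 2).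
Proof.
move=> d_gt0 xE hb; set c := mean x; set m := mean _ in hb.
set g := grad f c; set l := enorm g.
have Np : 0 < n%:R :> R by rewrite ltr0n.
have N1p : 0 < n.+1%:R :> R by rewrite ltr0n.
have s0 : n.+1%:R / n%:R * delta ^+ 2 != 0 :> R.
  by rewrite !mulf_neq0 ?invr_neq0 ?expf_neq0 ?gt_eqF.
have yE i : dot (x i - c) (x i - c) = delta ^+ 2.
  by rewrite (equilateral_gram _ _ xE) eqxx /=; field; rewrite n1 n0.
pose a i := dot g (x i - c).
have sum_a : \sum_i a i = 0 by rewrite -dot_sumr sum_sub_mean dot0r.
have al i : `|a i| <= l * delta.
  apply: le_trans (dot_cauchy _ _) _.
  by rewrite [enorm (x i - c)]enormE yE sqrtr_sqr (gtr0_norm d_gt0).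
have sum_f : \sum_i (f (x i) - m) = 0 by exact: (sum_sub_mean (fun i => f (x i))).
have l0 : 0 <= l by exact: enorm_ge0.
have term i : a i ^+ 2 <= l * delta * (b + nu / 2 * delta ^+ 2)
    + a i * (b + m - f c) - l * delta * (f (x i) - m).
  have := C11_taylor c (x i) f_C11; rewrite yE -/g -/(a i).
  set e := _ - a i => eb.
  (* The factor is nonnegative, so the one-sided bound on the value suffices. *)
  have H1 : (a i + l * delta) * (f (x i) - m) <= (a i + l * delta) * b.
    apply: ler_wpM2l (hb i); rewrite -lerBlDr sub0r.
    by have := al i; rewrite ler_norml => /andP[].
  have H2 : - (a i * e) <= l * delta * (nu / 2 * delta ^+ 2).
    apply: le_trans (ler_norm _) _; rewrite normrN normrM.
    by apply: ler_pM; rewrite ?normr_ge0.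
  have -> : a i ^+ 2 = a i * (f (x i) - f c) - a i * e by rewrite /e; ring.
  lra.
have := equilateral_tight g s0 xE.
rewrite -enorm_sqr -/l => tight.
have : \sum_i a i ^+ 2 <= n.+1%:R * (l * delta * (b + nu / 2 * delta ^+ 2)).
  apply: le_trans (ler_sum _ (fun i _ => term i)) _.
  rewrite sumrB big_split /= sumr_const card_ord -mulr_suml -mulr_sumr.
  by rewrite sum_a sum_f mul0r mulr0 subr0 addr0 [leRHS]mulr_natl.
rewrite tight => {}tight.
have b_ge0 : 0 <= b.
  have : \sum_i (f (x i) - m) <= \sum_(i < n.+1) b.
    by apply: ler_sum => i _; exact: hb.
  by rewrite sum_f sumr_const card_ord pmulrn_lge0.
have := l0; rewrite le_eqVlt => /predU1P[<-|l_gt0].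
  have nu2 : 0 <= nu / 2 * delta ^+ 2.
    by rewrite mulr_ge0 ?sqr_ge0// divr_ge0// ltW.
  by rewrite mulr_ge0 ?addr_ge0// divr_ge0// ltW.
have c_gt0 : 0 < n.+1%:R / n%:R * (l * delta ^+ 2).
  by rewrite mulr_gt0 ?divr_gt0// mulr_gt0 ?exprn_gt0.
rewrite -(ler_pM2l c_gt0); apply: etrans tight; congr (_ <= _); first by ring.
by field; rewrite n0 gt_eqF.
Qed.

End Estimates.

(** * Simplices as sets and their labelings *)

Section Labels.
Variables (R : realType) (n : nat).
Implicit Types (x : 'I_n.+1 -> 'rV[R]_n) (V : {fset 'rV[R]_n}) (s : R).

Lemma labels_sum x V (W : zmodType) (F : 'rV[R]_n -> W) : labels_simplex x V ->
  \sum_(u <- V) F u = \sum_i F (x i).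
Proof.
move=> [xV xI xS]; rewrite -(big_map x xpredT); apply: perm_big.
apply: uniq_perm; first exact: fset_uniq.
  by rewrite map_inj_uniq ?index_enum_uniq// => i j; apply: xI; rewrite inE.
move=> u; apply/idP/mapP => [uV|[i _ ->]]; last exact: xV.
by have [i _ <-] := xS u uV; exists i; rewrite ?mem_index_enum.
Qed.

Lemma labels_center x V : labels_simplex x V -> simplex_center V = mean x.
Proof. by move=> xV; rewrite /simplex_center (labels_sum id xV). Qed.

(** This lets regularity pass from the labeling produced by a reflection to the
sorted labeling of the next iteration. *)
Lemma labels_equilateral s x y V :
  labels_simplex x V -> labels_simplex y V -> equilateral s x -> equilateral s y.
Proof.
move=> [_ xI xS] [yV yI _] xE i j.
have [k _ kE] := xS (y i) (yV i I); have [l _ lE] := xS (y j) (yV j I).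
rewrite -kE -lE xE; congr (_ * (~~ _)%:R).
apply/eqP/eqP => [kl|ij].
  by apply: yI; rewrite ?inE// -kE kl lE.
by apply: xI; rewrite ?inE// kE ij lE.
Qed.

End Labels.

Lemma equilateral_inj (R : realType) (n : nat) (s : R)
    (x : 'I_n.+1 -> 'rV[R]_n) :
  0 < s -> equilateral s x -> injective x.
Proof.
move=> s_gt0 xE i j xij; apply/eqP; move: (xE i j).
rewrite xij subrr dot0r; case: eqP => // _ /eqP.
by rewrite mulr1 eq_sym mulf_eq0 pnatr_eq0/= gt_eqF.
Qed.

(** The reflected point is at positive distance from the retained vertices, so
the new set has again [n + 1] elements. *)
Lemma labels_reflect (R : realType) (n : nat) (s : R)
    (x : 'I_n.+1 -> 'rV[R]_n) (V : {fset 'rV[R]_n}) :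
  (0 < n)%N -> 0 < s -> equilateral s x -> labels_simplex x V ->
  labels_simplex (reflect_vertex x)
    ((V `\ x ord_max) `|` [fset reflection_point x])%fset.
Proof.
move=> n_gt0 s_gt0 xE [xV xI xS]; split.
- move=> i _ /=; rewrite !inE /reflect_vertex.
  case: (eqVneq i ord_max) => [_|i_max]; first by rewrite eqxx orbT.
  rewrite (inj_eq (equilateral_inj s_gt0 xE)) i_max /=.
  by rewrite (xV i I).
- move=> i j _ _; apply: equilateral_inj s_gt0 _ _ _.
  exact: equilateral_reflect.
- move=> u /=; rewrite !inE => /orP[/andP[u_max uV]|/eqP ->]; last first.
    by exists ord_max; rewrite // /reflect_vertex eqxx.
  have [i _ iu] := xS u uV; exists i => //.
  by rewrite /reflect_vertex ifN//; apply: contraNN u_max => /eqP <-; rewrite iu.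
Qed.

(** From [A = k B Q] with [Q] orthogonal and [B] a symmetric idempotent, [A A^T]
is [k^2 B]; the zero column of [A] does not contribute to this Gram matrix. *)
Lemma regular_simplex_equilateral (R : realType) (n : nat)
    (V : {fset 'rV[R]_n}) (c : 'rV[R]_n) (delta : R) :
  regular_simplex V c delta ->
  exists2 x, labels_simplex x V & equilateral (n.+1%:R / n%:R * delta ^+ 2) x.
Proof.
move=> [_ [x [xV _ _ [Q [QQ AE]]]]]; exists x => //.
apply: (@gram_equilateral _ _ _ _ c) => i j.
set k := Num.sqrt _ * _ in AE; set u : R := n.+1%:R^-1.
have BB : centering_mx R n *m (centering_mx R n)^T = centering_mx R n.
  pose J : 'M[R]_n.+1 := const_mx 1.
  have JJ : J *m J = n.+1%:R *: J.
    apply/matrixP => p q; rewrite !mxE mulr1 (eq_bigr (fun=> 1)).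
      by rewrite sumr_const card_ord.
    by move=> r _; rewrite !mxE mulr1.
  have -> : (centering_mx R n)^T = centering_mx R n.
    by apply/matrixP => p q; rewrite !mxE eq_sym.
  rewrite {1}/centering_mx mulmxBl mul1mx -scalemxAl -/J.
  rewrite /centering_mx mulmxBr mulmx1 -scalemxAr -/J JJ.
  rewrite scalerA mulVf ?pnatr_eq0//.
  by rewrite scale1r subrr scaler0 subr0.
have := congr1 (fun A => (A *m A^T) i j) AE.
rewrite trmx_mul mulmxA -(mulmxA _ Q) QQ mulmx1 linearZ /=.
rewrite -scalemxAl -scalemxAr scalerA BB.
set A := \matrix_p _ => E.
have -> : dot (x i - c) (x j - c) = (A *m A^T) i j.
  have Al p (q : 'I_1) : A p (lshift n q) = 0 by rewrite mxE row_mxEl mxE.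
  have Ar p (q : 'I_n) : A p (rshift 1 q) = (x p - c) 0 q.
    by rewrite mxE row_mxEr.
  rewrite mxE (@big_split_ord _ _ _ 1 n) big_ord1 Al /= mul0r add0r.
  by apply: eq_bigr => q _; rewrite [A^T _ _]mxE !Ar.
by rewrite E !mxE mulr1 -expr2 exprMn sqr_sqrtr ?divr_ge0//.
Qed.

(** * Termination and complexity *)

Theorem theorem7p8 (R : realType) (n : nat) (n_gt0 : (0 < n)%N)
    (nu : R) (nu_gt0 : 0 < nu)
    (f : 'rV[R]_n -> R) (f_C11 : C11 nu f)
    (fstar : R) (f_ge : forall u : 'rV[R]_n, fstar <= f u)
    (eps : R) (eps_gt0 : 0 < eps)
    (delta : R) (delta_def : delta = 2 * eps / (5 * n%:R * nu))
    (c0 : 'rV[R]_n)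
    (Theta : nat -> {fset 'rV[R]_n}) (x : nat -> 'I_n.+1 -> 'rV[R]_n)
    (run : simplicial_search_run f c0 delta (stopping_test f nu delta) Theta x) :
  exists k : nat,
    [/\ terminates_at (stopping_test f nu delta) x k,
        enorm (grad f (simplex_center (Theta k))) <= eps &
        k%:R <= 25 * n%:R ^+ 3 * nu / (8 * eps ^+ 2) *
                (n.+1%:R^-1 * (\sum_(u <- Theta 0%N) f u) - fstar)].
Proof.
set stop := stopping_test f nu delta in run *.
have [start label step] := run.
have n0 : n%:R != 0 :> R by rewrite pnatr_eq0 -lt0n.
have n1 : 1 + n%:R != 0 :> R by rewrite nat1r pnatr_eq0.
have nu0 : nu != 0 by rewrite gt_eqF.
have eps0 : eps != 0 by rewrite gt_eqF.
have delta_gt0 : 0 < delta by have [] := start.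
have n_pos : 0 < n%:R :> R by rewrite ltr0n.
pose s : R := n.+1%:R / n%:R * delta ^+ 2.
have s_gt0 : 0 < s by rewrite !mulr_gt0 ?invr_gt0 ?ltr0n ?exprn_gt0.
(* The guaranteed decrease of the average in one iteration. *)
pose D := 2 * nu * delta ^+ 2 / n%:R.
have D_gt0 : 0 < D by rewrite divr_gt0// !mulr_gt0 ?exprn_gt0.
pose m k : R := mean (fun i => f (x k i)).
have mean_ge k : fstar <= m k.
  rewrite /m /mean -[_ *: _]/(_ * _) ler_pdivlMl ?ltr0n//.
  rewrite [leLHS]mulr_natl -{1}(card_ord n.+1) -sumr_const.
  by apply: ler_sum.
have labelP k : (forall j, (j < k)%N -> ~~ stop (x j)) ->
    labels_simplex (x k) (Theta k) by move=> /label[].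
have inv k : (forall j, (j < k)%N -> ~~ stop (x j)) ->
    equilateral s (x k) /\ m k <= m 0%N - k%:R * D.
  elim: k => [_|k IH nstop].
    rewrite mul0r subr0; split=> //.
    have [y yV yE] := regular_simplex_equilateral start.
    by apply: labels_equilateral yV _ yE; apply: labelP.
  have nstop' j : (j < k)%N -> ~~ stop (x j) by move=> jk; apply/nstop/ltnW.
  have [xE mk] := IH nstop'.
  have yV := labels_reflect n_gt0 s_gt0 xE (labelP _ nstop').
  rewrite -step// in yV.
  have xV := labelP _ nstop.
  split; first exact: labels_equilateral yV xV (equilateral_reflect n_gt0 xE).
  have -> : m k.+1 = mean (fun i => f (reflect_vertex (x k) i)).
    by rewrite /m /mean -(labels_sum f xV) -(labels_sum f yV).
  have gap : 2 * n%:R / n.+1%:R * (nu * s) < f (x k ord_max) - m k.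
    have := nstop k (ltnSn k); rewrite /stop /stopping_test -ltNge.
    have -> // : 2 * n%:R / n.+1%:R * (nu * s) = 2 * nu * delta ^+ 2.
    by rewrite /s; field; rewrite n1 n0.
  apply: le_trans (mean_decrease n_gt0 f_C11 xE gap) _.
  have -> : 2 * (nu * s) / n.+1%:R = D by rewrite /D /s; field; rewrite n1 n0.
  by rewrite -/(m k) -natr1; lra.
have bound k : (forall j, (j < k)%N -> ~~ stop (x j)) ->
    k%:R * D <= m 0%N - fstar.
  by move=> /inv[_ mk]; have := mean_ge k; lra.
have ex_stop : exists k, stop (x k).
  apply: contrapT => /forallNP nstop.
  pose K := Num.bound ((m 0%N - fstar) / D).
  have := bound K (fun j _ => introN idP (nstop j)).
  rewrite -ler_pdivlMr// leNgt archi_boundP//.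
  by rewrite divr_ge0 ?subr_ge0 ?mean_ge// ltW.
have [k stopk kmin] := ex_minnP ex_stop; exists k.
have nstop j : (j < k)%N -> ~~ stop (x j).
  by move=> jk; apply: contraTN jk => /kmin; rewrite -leqNgt.
have [xE _] := inv k nstop; have [xV sorted] := label k nstop.
split; first by [].
  rewrite (labels_center xV).
  have small i : f (x k i) - m k <= 2 * nu * delta ^+ 2.
    by apply: le_trans _ stopk; rewrite lerB// sorted// -ltnS.
  apply: le_trans (gradient_bound n_gt0 nu_gt0 f_C11 delta_gt0 xE small) _.
  rewrite le_eqVlt; apply/orP; left; apply/eqP.
  by rewrite delta_def; field; rewrite nu0 n0 eps0.
rewrite (labels_sum f (labelP 0%N _))// -[n.+1%:R^-1 * _]/(m 0%N).
have -> : 25 * n%:R ^+ 3 * nu / (8 * eps ^+ 2) = D^-1.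
  by rewrite /D delta_def; field; rewrite nu0 n0 eps0.
by rewrite mulrC ler_pdivlMr// bound.
Qed.
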